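(* Let $w_1,w_2,w_3,w_4$ be real numbers with $w_1\ge w_2\ge w_3\ge w_4$ and let $p(x)=(x-w_1)(x-w_2)(x-w_3)(x-w_4)$. Then $p(x)$ has a hyperbolic antiderivative if and only if $w^t A w\geq 0$, where $w=(w_1,w_2,w_3,w_4)$ (regarded as a column vector) and \[ A=\begin{bmatrix} 6 & -5 & -5 & 4\\ -5 & 0 & 10 & -5\\ -5 & 10 & 0 & -5\\ 4 & -5 & -5 & 6 \end{bmatrix}. \]
   Context: A polynomial is called hyperbolic if all of its (complex) zeros are real. A polynomial $p$ has a hyperbolic antiderivative if there exists a hyperbolic polynomial $Q$ with $Q'=p$. *)

(* Defs.v *)
From mathcomp Require Import all_boot all_order all_algebra.
From mathcomp Require Import complex reals.

Set Implicit Arguments.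
Unset Strict Implicit.
Unset Printing Implicit Defensive.

Import Order.TTheory GRing.Theory Num.Theory.
Local Open Scope ring_scope.
Local Open Scope complex_scope.

Definition hyperbolic (R : realType) (p : {poly R[i]}) : Prop :=
  forall z : R[i], root p z -> complex.Im z = 0.

Definition has_hyperbolic_antiderivative (R : realType) (p : {poly R[i]}) : Prop :=
  exists Q : {poly R[i]}, hyperbolic Q /\ Q^`() = p.

Definition matA (R : realType) : 'M[R]_4 :=
  \matrix_(i < 4, j < 4)
    (nth [::] [:: [::  6; -5; -5;  4];
                  [:: -5;  0; 10; -5];
                  [:: -5; 10;  0; -5];
                  [::  4; -5; -5;  6]] i)`_j.

Definition col4 (R : realType) (w1 w2 w3 w4 : R) : 'cV[R]_4 :=
  \col_(i < 4) [:: w1; w2; w3; w4]`_i.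

(* Main.v *)
(* The antiderivative of p vanishing at w1 is F(x) = (x - w1)^2 g(x) / 60 with g
   an explicit cubic, and F(w4) is a nonnegative multiple of w^T A w.

   If some F + c is hyperbolic, then, as its logarithmic derivative at a critical
   point w is the sum of the 1 / (w - r) over its roots r, the
   roots of F + c cannot all lie on one side of w: there are roots r1 >= w1 and
   r4 <= w4.  Since F increases on [w1, oo) and on
   (-oo, w4], F(w1) <= F(r1) = F(r4) <= F(w4), i.e. w^T A w >= 0.

   Conversely, put the double root at whichever of w1, w3 has the larger value
   of F.  A real cubic g with positive leading coefficient and a nonreal root
   u + iv is ((x - u)^2 + v^2) times an increasing affine function, so
   g(x) >= 0 >= g(y) for some x < y forces its roots to be real; this applies
   with x = w4 and y the other of w1, w3. *)
Require Import Defs.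
From mathcomp Require Import all_boot all_order all_algebra.
From mathcomp Require Import complex reals.
From mathcomp Require Import ring lra.
Import Order.TTheory GRing.Theory Num.Theory.
Local Open Scope ring_scope.
Local Open Scope complex_scope.

Lemma complex_cubic_root_real {R : rcfType} (k c2 c1 c0 a b : R) (z : R[i]) :
  0 < k -> a < b ->
  k * a ^+ 3 + c2 * a ^+ 2 + c1 * a + c0 >= 0 ->
  k * b ^+ 3 + c2 * b ^+ 2 + c1 * b + c0 <= 0 ->
  k%:C * z ^+ 3 + c2%:C * z ^+ 2 + c1%:C * z + c0%:C = 0 ->
  complex.Im z = 0.
Proof.
case: z => u v /= k0 ab ga gb /eqP.
rewrite !exprS expr0; simpc. rewrite eq_complex /= => /andP[/eqP hre /eqP him].
apply/eqP; apply: contraT => v0; exfalso.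
have v2 : 0 < v ^+ 2 by rewrite exprn_even_gt0.
(* [v] times this expression is the imaginary part of the cubic at [u + iv]. It determines [c1], and
   the real part then determines [c0]. *)
have him' : k * (3 * u ^+ 2 - v ^+ 2) + 2 * c2 * u + c1 = 0.
  by apply: (mulfI v0); rewrite mulr0 -[RHS]him; ring.
have fact x : k * x ^+ 3 + c2 * x ^+ 2 + c1 * x + c0
    = ((x - u) ^+ 2 + v ^+ 2) * (k * (x + 2 * u) + c2).
  have c1E : c1 = - (k * (3 * u ^+ 2 - v ^+ 2) + 2 * c2 * u).
    by apply/eqP; rewrite -addr_eq0 addrC him'.
  have c0E : c0 = - (k * (u ^+ 3 - 3 * u * v ^+ 2) + c2 * (u ^+ 2 - v ^+ 2)
                     + c1 * u).
    by apply/eqP; rewrite -addr_eq0; apply/eqP; rewrite -[RHS]hre; ring.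
  by rewrite c0E c1E; ring.
have quad_gt0 x : 0 < (x - u) ^+ 2 + v ^+ 2 by rewrite ltr_wpDl // sqr_ge0.
move: ga gb; rewrite !fact pmulr_rge0 // pmulr_rle0 // => ga gb.
have : 0 < k * (b - a) by rewrite mulr_gt0 // subr_gt0.
lra.
Qed.

Definition quartic {R : comNzRingType} (w a b c : R) : {poly R} :=
  ('X - w%:P) * ('X - a%:P) * ('X - b%:P) * ('X - c%:P).

(* 60 times the antiderivative of [quartic w a b c] vanishing at [w] is
   [('X - w%:P) ^+ 2 * cofactor w a b c]. *)
Definition cofactor {R : comNzRingType} (w a b c : R) : {poly R} :=
  let Y := 'X - w%:P in
  12 *: Y ^+ 3 - (15 * ((a - w) + (b - w) + (c - w))) *: Y ^+ 2
  + (20 * ((a - w) * (b - w) + (a - w) * (c - w) + (b - w) * (c - w))) *: Y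
  - (30 * ((a - w) * (b - w) * (c - w)))%:P.

Definition antideriv {R : numFieldType} (w a b c : R) : {poly R} :=
  60^-1 *: (('X - w%:P) ^+ 2 * cofactor w a b c).

Lemma deriv_antideriv {R : numFieldType} (w a b c : R) :
  (antideriv w a b c)^`() = quartic w a b c.
Proof.
rewrite /antideriv /cofactor /quartic -!mul_polyC !polyCM !polyC_natr.
rewrite !polyCD !polyCM !polyCD !polyCN.
have K60 : 60 * (60^-1)%:P = 1 :> {poly R}.
  by rewrite -polyC_natr -polyCM divff ?pnatr_eq0.
have n60 : 60 != 0 :> {poly R} by rewrite -polyC_natr polyC_eq0 pnatr_eq0.
(* Multiplying by 60 leaves an identity with integer coefficients, within reach of [ring]. *)
apply: (mulfI n60); rewrite derivM derivC mul0r add0r [LHS]mulrA K60 mul1r.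
rewrite !exprS expr0 !derivE.
ring.
Qed.

Lemma horner_cofactor {R : comNzRingType} (w a b c x : R) :
  (cofactor w a b c).[x] = 12 * (x - w) ^+ 3
  - 15 * ((a - w) + (b - w) + (c - w)) * (x - w) ^+ 2
  + 20 * ((a - w) * (b - w) + (a - w) * (c - w) + (b - w) * (c - w)) * (x - w)
  - 30 * ((a - w) * (b - w) * (c - w)).
Proof. by rewrite /cofactor !hornerE. Qed.

Lemma horner_antideriv {R : numFieldType} (w a b c x : R) :
  (antideriv w a b c).[x] = 60^-1 * ((x - w) ^+ 2 * (cofactor w a b c).[x]).
Proof. by rewrite /antideriv !hornerE. Qed.

(** A root is either the real double root [w] or a root of the cofactor, a cubic in [X - w];
    translation by [w] reduces it to [complex_cubic_root_real]. *)
Lemma hyperbolic_antideriv {R : realType} (w a b c x y : R) :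
  x < y -> 0 <= (cofactor w a b c).[x] -> (cofactor w a b c).[y] <= 0 ->
  hyperbolic (map_poly (real_complex R) (antideriv w a b c)).
Proof.
move=> xy; rewrite !horner_cofactor => gx gy z.
have xy' : x - w < y - w by rewrite ltrD2r.
rewrite /antideriv map_polyZ rmorphM rmorphXn rmorphB /= map_polyX map_polyC /=.
rewrite rootZ ?fmorph_eq0 ?invr_eq0 ?pnatr_eq0 // rootM => /orP[].
  by rewrite rootE !hornerE expf_eq0 /= subr_eq0 => /eqP ->.
rewrite rootE /cofactor !(rmorphB, rmorphD) /= !map_polyZ /= !(rmorphXn, rmorphB) /=.
rewrite !(map_polyX, map_polyC) /=.
rewrite !(hornerD, hornerN, hornerZ, horner_exp, hornerXsubC, hornerX, hornerC) => /eqP gz.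
have : complex.Im (z - w%:C) = 0.
  apply: (@complex_cubic_root_real _ 12
    (- (15 * ((a - w) + (b - w) + (c - w))))
    (20 * ((a - w) * (b - w) + (a - w) * (c - w) + (b - w) * (c - w)))
    (- (30 * ((a - w) * (b - w) * (c - w)))) _ _ _ _ xy').
  - by rewrite ltr0n.
  - by rewrite mulNr.
  - by rewrite mulNr.
  - by rewrite -[RHS]gz !rmorphN /= mulNr.
by case: z {gz} => u v; rewrite /= ?oppr0 ?addr0 ?subr0.
Qed.

(* [eps] is 1 or -1 according to the side of [w] on which the roots lie. *)
Lemma prod_XsubC_log_deriv {R : realFieldType} (eps w : R) (s : seq R) :
  (forall r, r \in s -> 0 < eps * (w - r)) ->
  let P := \prod_(r <- s) ('X - r%:P) in
  P.[w] != 0 /\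
  exists2 t, P^`().[w] = P.[w] * t & if s is [::] then t = 0 else 0 < eps * t.
Proof.
elim: s => [|r s IH] sP /=.
  rewrite big_nil derivC !hornerE oner_eq0; split=> //; exists 0; by rewrite ?mulr0.
have [|Pw [t dPw tP]] := IH; first by move=> x xs; apply: sP; rewrite in_cons xs orbT.
have er : 0 < eps * (w - r) by apply: sP; rewrite mem_head.
have wr : w - r != 0 by apply: contraTneq er => ->; rewrite mulr0 ltxx.
rewrite big_cons; split; first by rewrite !hornerE mulf_neq0.
(* [t] accumulates the logarithmic derivative, the sum of the [(w - r)^-1]. *)
exists ((w - r)^-1 + t); first by rewrite !(derivE, hornerE) dPw; field.
have e1 : 0 < eps * (w - r)^-1.
  suff -> : eps * (w - r)^-1 = eps * (w - r) * ((w - r)^-1) ^+ 2.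
    by rewrite mulr_gt0 // exprn_even_gt0 // invr_eq0.
  by field.
rewrite mulrDr.
by case: s tP {IH sP Pw dPw} => [->|_ _ tP]; rewrite ?mulr0 ?addr0 ?addr_gt0.
Qed.

(** One-sided Gauss-Lucas: [eps = 1] yields a root at or above [w], [eps = -1] one at or below
    it. *)
Lemma hyperbolic_crit_root {R : realType} (Q : {poly R[i]}) (eps w : R) :
  hyperbolic Q -> Q^`() != 0 -> root Q^`() w%:C ->
  exists2 r : R, root Q r%:C & eps * (w - r) <= 0.
Proof.
move=> hQ dQ0 rw.
have [s' Qs'] := closed_field_poly_normal Q.
have lQ0 : lead_coef Q != 0.
  by apply: contraNneq dQ0 => l0; rewrite Qs' l0 scale0r deriv0.
(* All roots being real, [Q] is a complex scalar times the real polynomial [P]. *)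
pose s := map (@complex.Re R) s'; pose P := \prod_(r <- s) ('X - r%:P).
have QP : Q = lead_coef Q *: map_poly (real_complex R) P.
  rewrite [LHS]Qs' /P rmorph_prod big_map; congr (_ *: _).
  rewrite !big_seq; apply: eq_bigr => z zs; rewrite rmorphB /= map_polyX map_polyC /=.
  suff -> : z = (complex.Re z)%:C by [].
  have := hQ z; rewrite Qs' rootZ // root_prod_XsubC => /(_ zs).
  by case: z {zs} => u v /= ->.
have rootQ x : root Q x%:C = root P x by rewrite QP rootZ // fmorph_root.
have [/hasP[r rs er]|/hasPn sP] := boolP (has (fun r => eps * (w - r) <= 0) s).
  by exists r; rewrite // rootQ root_prod_XsubC.
have [|Pw [t dPw tP]] := prod_XsubC_log_deriv eps w s.
  by move=> r /sP; rewrite -ltNge.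
rewrite -/P in Pw dPw.
have t0 : t = 0.
  move: rw; rewrite QP derivZ deriv_map rootZ // fmorph_root rootE dPw.
  by rewrite mulf_eq0 (negPf Pw) => /eqP.
case: s tP @P QP {rootQ sP Pw dPw} => [_|r s + P _]; last by rewrite t0 mulr0 ltxx.
by move=> P QP; rewrite QP /P big_nil rmorph1 derivZ derivC scaler0 eqxx in dQ0.
Qed.

Lemma eq_deriv_horner {K : numDomainType} (p q : {poly K}) (x y : K) :
  p^`() = q^`() -> p.[x] - p.[y] = q.[x] - q.[y].
Proof.
move=> dpq.
have -> : p = q + (p`_0 - q`_0)%:P.
  apply/polyP => -[|i]; rewrite coefD coefC /=; first by rewrite addrC subrK.
  rewrite addr0; apply: (@mulIf _ i.+1%:R); first by rewrite pnatr_eq0.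
  by rewrite !mulr_natr -!coef_deriv dpq.
by rewrite !hornerD !hornerC opprD addrACA subrr addr0.
Qed.

(** A translation-invariant shape, visibly zero when all four numbers coincide. *)
Lemma form_matA (R : realType) (w1 w2 w3 w4 : R) :
  let w := col4 w1 w2 w3 w4 in
  (w^T *m matA R *m w) 0 0 =
  (w1 - w4) ^+ 2 + 5 * (2 * w2 - w1 - w4) * (2 * w3 - w1 - w4).
Proof.
rewrite /= !(mxE, big_ord_recl, big_ord0) /=.
ring.
Qed.

(** In terms of the gaps to [w] all coefficients are nonnegative; this replaces a monotonicity
    argument for the antiderivative. *)
Lemma cofactor_ge0 (R : realFieldType) (w a b c x : R) :
  a <= w -> b <= w -> c <= w -> w <= x -> 0 <= (cofactor w a b c).[x].
Proof.
rewrite -!(subr_ge0 _ w) -(subr_ge0 w) => a0 b0 c0 x0.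
have -> : (cofactor w a b c).[x] = 12 * (x - w) ^+ 3
  + 15 * ((w - a) + (w - b) + (w - c)) * (x - w) ^+ 2
  + 20 * ((w - a) * (w - b) + (w - a) * (w - c) + (w - b) * (w - c)) * (x - w)
  + 30 * ((w - a) * (w - b) * (w - c)) by rewrite horner_cofactor; ring.
by do ?[done | exact: ler0n | exact: exprn_ge0 |
        apply: addr_ge0 | apply: mulr_ge0].
Qed.

(** The reflection that carries sign statements from the right of [w] to its left. *)
Lemma cofactorN (R : comNzRingType) (w a b c x : R) :
  (cofactor (- w) (- a) (- b) (- c)).[- x] = - (cofactor w a b c).[x].
Proof. by rewrite !horner_cofactor; ring. Qed.

Lemma cofactor_le0 (R : realFieldType) (w a b c x : R) :
  w <= a -> w <= b -> w <= c -> x <= w -> (cofactor w a b c).[x] <= 0.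
Proof. by move=> *; rewrite -oppr_ge0 -cofactorN cofactor_ge0 ?lerN2. Qed.

Lemma hyperbolic_XsubC_exp (R : realType) (w k : R) (n : nat) :
  k != 0 -> hyperbolic (map_poly (real_complex R) (k *: ('X - w%:P) ^+ n)).
Proof.
move=> k0 z; rewrite map_polyZ rmorphXn rmorphB /= map_polyX map_polyC /=.
rewrite rootZ ?fmorph_eq0 // rootE horner_exp hornerXsubC expf_eq0 subr_eq0.
by move=> /andP[_ /eqP ->].
Qed.

Theorem theorem2p3 (R : realType) (w1 w2 w3 w4 : R)
    (h12 : w1 >= w2) (h23 : w2 >= w3) (h34 : w3 >= w4) :
  let p : {poly R[i]} :=
    ('X - w1%:C%:P) * ('X - w2%:C%:P) * ('X - w3%:C%:P) * ('X - w4%:C%:P) in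
  let w : 'cV[R]_4 := col4 w1 w2 w3 w4 in
  has_hyperbolic_antiderivative p <-> (w^T *m matA R *m w) 0 0 >= 0.
Proof.
move=> p w; rewrite form_matA.
have pE : p = map_poly (real_complex R) (quartic w1 w2 w3 w4).
  by rewrite /p /quartic !rmorphM !rmorphB /= !map_polyX !map_polyC.
set q := (X in _ <-> 0 <= X).
have F14 : 60 * (antideriv w1 w2 w3 w4).[w4] = (w1 - w4) ^+ 3 / 2 * q.
  rewrite horner_antideriv horner_cofactor /q; by field.
split=> [[Q [hQ dQ]]|q0].
  have p0 : p != 0 by rewrite !mulf_neq0 // polyXsubC_eq0.
  have [||r1 Qr1 r1w] := hyperbolic_crit_root Q 1 w1 hQ; rewrite ?dQ //.
    by rewrite /p !rootM root_XsubC eqxx.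
  have [||r4 Qr4 r4w] := hyperbolic_crit_root Q (- 1) w4 hQ; rewrite ?dQ //.
    by rewrite /p !rootM !root_XsubC eqxx !orbT.
  have Fr : (antideriv w1 w2 w3 w4).[r1] = (antideriv w1 w2 w3 w4).[r4].
    apply: (@complexI R); rewrite -!horner_map; apply/eqP; rewrite -subr_eq0.
    rewrite (@eq_deriv_horner _ _ Q); last by rewrite deriv_map deriv_antideriv dQ.
    by rewrite (rootP Qr1) (rootP Qr4) subrr.
  rewrite mul1r subr_le0 in r1w; rewrite mulN1r opprB subr_le0 in r4w.
  have F1 : 0 <= (antideriv w1 w2 w3 w4).[r1].
    have g1 : 0 <= (cofactor w1 w2 w3 w4).[r1] by apply: cofactor_ge0; lra.
    by rewrite horner_antideriv mulr_ge0 ?invr_ge0 ?ler0n // mulr_ge0 ?sqr_ge0.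
  have F4 : (antideriv w4 w1 w2 w3).[r4] <= 0.
    have g4 : (cofactor w4 w1 w2 w3).[r4] <= 0 by apply: cofactor_le0; lra.
    by rewrite horner_antideriv pmulr_rle0 ?invr_gt0 ?ltr0n // mulr_ge0_le0 ?sqr_ge0.
  (* The antiderivatives based at [w1] and [w4] differ by a constant, so [F4] says that the first is
     at most its value at [w4] when evaluated at [r4]. *)
  have F41 : (antideriv w1 w2 w3 w4).[w4] =
      (antideriv w1 w2 w3 w4).[r4] - (antideriv w4 w1 w2 w3).[r4].
    rewrite !horner_antideriv !horner_cofactor; by field.
  have : 0 <= (w1 - w4) ^+ 3 / 2 * q.
    by rewrite -F14 mulr_ge0 ?ler0n // F41 subr_ge0 (le_trans F4) // -Fr.
  (* If [w1 = w4] the factor in front of [q] vanishes, but then all four numbers agree and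
     [q = 0]. *)
  have [w14|] := ltP w4 w1.
    by rewrite pmulr_rge0 // mulr_gt0 ?invr_gt0 ?ltr0n // exprn_gt0 // subr_gt0.
  move=> w14 _; have e3 : w3 = w4 by lra.
  have e2 : w2 = w4 by lra.
  have e1 : w1 = w4 by lra.
  by rewrite /q e1 e2 e3; lra.
suff [F hF dF] : exists2 F : {poly R}, hyperbolic (map_poly (real_complex R) F) &
    F^`() = quartic w1 w2 w3 w4.
  by exists (map_poly (real_complex R) F); split; rewrite // deriv_map dF pE.
have d1 := deriv_antideriv w1 w2 w3 w4.
have d3 : (antideriv w3 w1 w2 w4)^`() = quartic w1 w2 w3 w4.
  by rewrite deriv_antideriv /quartic; ring.
have g14 : 0 <= (cofactor w1 w2 w3 w4).[w4].
  have -> : (cofactor w1 w2 w3 w4).[w4] = (w1 - w4) / 2 * q.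
    by rewrite horner_cofactor /q; field.
  by rewrite !mulr_ge0 ?invr_ge0 ?ler0n // subr_ge0; lra.
(* Hence one of the base points [w1], [w3] has a cofactor that is nonpositive at the other. *)
have g13 : (cofactor w1 w2 w3 w4).[w3] = - (cofactor w3 w1 w2 w4).[w1].
  by rewrite !horner_cofactor; ring.
(* If [w1 = w3], the cofactor based at [w1] vanishes at [w3], which suffices when [w4 < w3];
   otherwise all four numbers agree and a fifth power serves. *)
have [w31|w13] := ltP w3 w1; last first.
  have [w43|w34] := ltP w4 w3.
    exists (antideriv w1 w2 w3 w4) => //.
    apply: (hyperbolic_antideriv _ _ _ _ _ _ w43 g14).
    have -> : w3 = w1 by lra.
    by rewrite horner_cofactor; lra.
  have e3 : w3 = w4 by lra.
  have e2 : w2 = w4 by lra.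
  have e1 : w1 = w4 by lra.
  exists (5^-1 *: ('X - w4%:P) ^+ 5).
    by apply: hyperbolic_XsubC_exp; rewrite invr_eq0 pnatr_eq0.
  rewrite e1 e2 e3 /quartic derivZ deriv_exp derivXsubC mul1r -scaler_nat scalerA.
  by rewrite mulVf ?pnatr_eq0 // scale1r /=; ring.
have [g31|g31] := leP (cofactor w3 w1 w2 w4).[w1] 0.
  exists (antideriv w3 w1 w2 w4) => //.
  apply: (hyperbolic_antideriv _ _ _ _ _ _ _ _ g31); first exact: le_lt_trans h34 w31.
  (* All terms are nonnegative: the antiderivative does not increase from [w4] to [w3]. *)
  have -> : (cofactor w3 w1 w2 w4).[w4] = (w3 - w4) * (3 * (w3 - w4) ^+ 2
    + 5 * ((w1 - w3) + (w2 - w3)) * (w3 - w4) + 10 * ((w1 - w3) * (w2 - w3))).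
    by rewrite horner_cofactor; ring.
  have d34 : 0 <= w3 - w4 by lra.
  have d31 : 0 <= w1 - w3 by lra.
  have d32 : 0 <= w2 - w3 by lra.
  by do ?[done | exact: ler0n | exact: sqr_ge0 |
          apply: addr_ge0 | apply: mulr_ge0].
exists (antideriv w1 w2 w3 w4) => //.
have g13' : (cofactor w1 w2 w3 w4).[w3] < 0 by rewrite g13 oppr_lt0.
apply: (hyperbolic_antideriv _ _ _ _ _ _ _ g14 (ltW g13')).
(* [w3 = w4] would give the cofactor two incompatible signs at one point. *)
rewrite lt_neqAle h34 andbT; apply/eqP => e.
by move: g14 g13'; rewrite e => g0 /(le_lt_trans g0); rewrite ltxx.
Qed.
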